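(* Let $k$ be an algebraically closed field of characteristic zero, let $2\le n<d$ and $0\le\alpha_0\le\cdots\le\alpha_n<d$ be integers with $\mathrm{GCD}(\alpha_0,\ldots,\alpha_n,d)=1$, and let $e\in k$ be a primitive $d$th root of unity. Let $\Lambda\subset GL(n+1,k)$ be the cyclic group of order $d$ generated by $\mathrm{diag}(e^{\alpha_0},\ldots,e^{\alpha_n})$, let $m_1,\ldots,m_{\mu_d}$ be all the monomials of degree $d$ in $R=k[x_0,\ldots,x_n]$ which are invariants of $\Lambda$, and let $X_d\subset\mathbb{P}^{\mu_d-1}$ be the image of the morphism $\mathbb{P}^n\to\mathbb{P}^{\mu_d-1}$ defined by $(m_1,\ldots,m_{\mu_d})$. Then for every $t\ge1$ the Hilbert function $HF(X_d,t)$ of $X_d$ in degree $t$ equals the number of monomials of degree $td$ in $R$ which are invariants of $\Lambda$.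
   Context: A diagonal matrix $\mathrm{diag}(c_0,\ldots,c_n)$ acts on $R$ by $x_i\mapsto c_i x_i$. With $S=k[w_1,\ldots,w_{\mu_d}]$ and $I(X_d)\subset S$ the homogeneous ideal of $X_d$, $HF(X_d,t)=\dim_k (S/I(X_d))_t$. *)

(* Defs.v *)
From mathcomp Require Import all_boot all_order all_algebra.
From mathcomp.classical Require Import boolp classical_sets.
From mathcomp Require Import mpoly.

Set Implicit Arguments.
Unset Strict Implicit.
Unset Printing Implicit Defensive.

Import GRing.Theory.
Local Open Scope ring_scope.

(* The dimension of a quotient V / W, where the subspace W is a Prop-valued
   predicate and V need not be a vectType: a basis of V / W is a finite family
   of V whose classes modulo W are generating and linearly independent. *)
Section QuotientDim.
Variables (k : fieldType) (V : lmodType k).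
Implicit Type W : V -> Prop.

Definition spans_mod W h (b : 'I_h -> V) : Prop :=
  forall v, exists c : 'I_h -> k, W (v - \sum_(i < h) c i *: b i).

Definition free_mod W h (b : 'I_h -> V) : Prop :=
  forall c : 'I_h -> k, W (\sum_(i < h) c i *: b i) -> forall i, c i = 0.

Definition basis_mod W h (b : 'I_h -> V) : Prop :=
  spans_mod W b /\ free_mod W b.

(* With the junk value 0 when V / W is not finite dimensional. *)
Definition quotient_dim W : nat :=
  xget 0%N (fun h => exists b : 'I_h -> V, basis_mod W b).

Definition is_subspace W : Prop :=
  W 0 /\ forall (a : k) (u v : V), W u -> W v -> W (a *: u + v).

Lemma subspace_sum W I (r : seq I) (c : I -> k) (F : I -> V) :
  is_subspace W -> (forall i, W (F i)) -> W (\sum_(i <- r) c i *: F i).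
Proof.
case=> W0 WD WF; elim: r => [|i r IHr]; first by rewrite big_nil.
by rewrite big_cons; apply: WD.
Qed.

Lemma leq_free_spans W h (b : 'I_h -> V) h' (b' : 'I_h' -> V) :
  is_subspace W -> free_mod W b' -> spans_mod W b -> (h' <= h)%N.
Proof.
move=> WS fb' sb; rewrite leqNgt; apply/negP => lt_hh'.
have [A AP] := choice (fun i => sb (b' i)).
pose M := \matrix_(i < h', j < h) A i j.
have : kermx M != 0.
  rewrite kermx_eq0 /row_free; apply/eqP => rM.
  by move: (rank_leq_col M); rewrite rM leqNgt lt_hh'.
case/rowV0Pn => u /sub_kermxP uM /eqP; apply.
apply/rowP => i; rewrite mxE; move: i; apply: fb'.
have -> : \sum_(i < h') u ord0 i *: b' i =
    \sum_(i < h') u ord0 i *: (b' i - \sum_(j < h) A i j *: b j).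
  under [RHS]eq_bigr do rewrite scalerBr.
  rewrite sumrB; apply/esym/eqP; rewrite subr_eq addrC -subr_eq subrr eq_sym.
  apply/eqP; under eq_bigr do rewrite scaler_sumr.
  rewrite exchange_big big1 // => j _.
  under eq_bigr do rewrite scalerA.
  rewrite -scaler_suml.
  have := congr1 (fun N : 'rV_h => N ord0 j) uM; rewrite !mxE.
  by under eq_bigr do rewrite mxE; move=> ->; rewrite scale0r.
exact: (subspace_sum (index_enum _) (fun i => u ord0 i)).
Qed.

Lemma quotient_dim_unique W h (b : 'I_h -> V) :
  is_subspace W -> basis_mod W b -> quotient_dim W = h.
Proof.
move=> WS [sb fb]; rewrite /quotient_dim; case: xgetP => [h' _ | nb].
  by case=> b' [sb' fb']; apply/eqP; rewrite eqn_leq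
    (leq_free_spans WS fb' sb) (leq_free_spans WS fb sb').
by case: (nb h); exists b; split.
Qed.

Lemma quotient_basis_exists W h (s : 'I_h -> V) :
    is_subspace W -> spans_mod W s ->
  exists b : 'I_(quotient_dim W) -> V, basis_mod W b.
Proof.
move=> WS.
suff bas m : (m <= h)%N -> forall b : 'I_m -> V, spans_mod W b ->
    exists h (b : 'I_h -> V), basis_mod W b.
  by case/(bas h) => // m [b bb]; rewrite (quotient_dim_unique WS bb); exists b.
elim: m => [|m IHm] ltmh b sb; first by exists 0%N, b; split => // c _ [].
have [fb|] := pselect (free_mod W b).
  by exists m.+1, b.
case/existsNP => c /not_implyP[Wc /existsNP[i /eqP ci0]].
apply: (IHm (ltnW ltmh) (fun j => b (lift i j))) => v.
have [a Wa] := sb v; case: WS => _ WD.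
exists (fun j => a (lift i j) - a i / c i * c (lift i j)).
have := WD (a i / c i) _ _ Wc Wa; congr W.
rewrite (bigD1_ord i) //= [in X in _ + (v - X)](bigD1_ord i) //=.
rewrite scalerDr scalerA divfK // scaler_sumr.
under [in RHS]eq_bigr do rewrite scalerBl -scalerA.
rewrite sumrB opprB opprD !addrA; set x := a i *: b i.
set y := \sum_(j < m) _; set z := \sum_(j < m) _.
by rewrite -[x + y + v]addrA [x + _]addrC addrK [y + v]addrC.
Qed.

End QuotientDim.

Section Projective.
Variables (k : fieldType) (m : nat).

(* The points of P^(m-1) are the lines of k^m. *)
Definition proj_point : Type := {P : {vspace 'rV[k]_m} | \dim P == 1%N}.

(* f vanishes at P if it does at all homogeneous coordinate vectors of P. *)
Definition vanishes_at (f : {mpoly k[m]}) (P : proj_point) : Prop :=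
  forall v : 'rV[k]_m, v \in val P -> v != 0 -> f.@[v ord0] = 0.

Implicit Type X : proj_point -> Prop.

(* The ideal of X is generated by the homogeneous forms vanishing on X. *)
Definition ideal_gen X (f : {mpoly k[m]}) : Prop :=
  (exists t, f \is t.-homog) /\ forall P, X P -> vanishes_at f P.

Definition vanishing_ideal X (f : {mpoly k[m]}) : Prop :=
  exists2 s : seq ({mpoly k[m]} * {mpoly k[m]}),
    forall p, p \in s -> ideal_gen X p.2
    & f = \sum_(p <- s) p.1 * p.2.

(* (S / I(X))_t is S_t / (I(X) \cap S_t), where S_t = dhomog m k t. *)
Definition hilbert_function X (t : nat) : nat :=
  quotient_dim (fun f : dhomog m k t => vanishing_ideal X (val f)).

Lemma vanishing_ideal_subspace X t :
  is_subspace (fun f : dhomog m k t => vanishing_ideal X (val f)).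
Proof.
split=> [|a u v [s sX su] [r rX rv]].
  by exists [::]; rewrite // big_nil linear0.
exists ([seq (a *: p.1, p.2) | p <- s] ++ r).
  move=> p; rewrite mem_cat => /orP[/mapP[q qs ->]|]; last exact: rX.
  by apply: (sX q); exact: qs.
rewrite big_cat big_map linearP /= -/(val u) -/(val v) su rv scaler_sumr.
by congr (_ + _); apply: eq_bigr => p _; exact: scalerAl.
Qed.

Lemma hilbert_function_basis X t :
  exists b : 'I_(hilbert_function X t) -> dhomog m k t,
    basis_mod (fun f : dhomog m k t => vanishing_ideal X (val f)) b.
Proof.
pose T := 'X_{1..m < t.+1}.
apply: (@quotient_basis_exists _ _ _ #|{: T}|
  (fun i => indhomog t 'X_[val (enum_val i : T)])).
  exact: vanishing_ideal_subspace.
move=> f; exists (fun i => (val f)@_(val (enum_val i : T))).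
rewrite [X in f - X](_ : _ = f).
  by rewrite subrr; case: (vanishing_ideal_subspace X t).
have ft := dhomog_is_dhomog f.
apply: val_inj; rewrite raddf_sum /=.
have sz : (msize (val f) <= t.+1)%N.
  rewrite msizeE big_seq; apply: (big_ind (fun x => x <= t.+1)%N) => //.
    by move=> x y xt yt; rewrite geq_max xt.
  by move=> w wf; rewrite (dhomog_mf ft wf).
rewrite [RHS](mpolywE sz).
rewrite (reindex (@enum_val _ (pred_of_simpl (@predT T)))) /=; last first.
  exact: onW_bij (@enum_val_bij T).
apply: eq_bigr => i _; set w := val (enum_val i : T).
have [wt|nwt] := eqVneq (mdeg w) t.
  have Xt : ('X_[w] : {mpoly k[m]}) \is t.-homog.
    by rewrite dhomogX; apply/eqP.
  by rewrite /indhomog insubdK.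
by rewrite (dhomog_nemf_coeff ft nwt) !scale0r.
Qed.

End Projective.

Section Invariants.
Variables (k : closedFieldType) (n : nat).

(* The linear substitution x_i |-> \sum_j A i j x_j. *)
Definition lin_act (A : 'M[k]_n.+1) (p : {mpoly k[n.+1]}) : {mpoly k[n.+1]} :=
  p \mPo [tuple \sum_(j < n.+1) A i j *: 'X_j | i < n.+1].

Lemma lin_act_diag (c : 'rV[k]_n.+1) (p : {mpoly k[n.+1]}) :
  lin_act (diag_mx c) p = p \mPo [tuple c ord0 i *: 'X_i | i < n.+1].
Proof.
congr (p \mPo _); apply: eq_mktuple => i.
rewrite (bigD1 i) //= big1 => [|j ji]; first by rewrite addr0 mxE eqxx.
by rewrite mxE eq_sym (negPf ji) scale0r.
Qed.

Definition Lambda (e : k) (alpha : 'I_n.+1 -> nat) (A : 'M[k]_n.+1) : Prop :=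
  exists j : int, A = diag_mx (\row_i e ^+ alpha i) ^ j.

Definition invariant (e : k) (alpha : 'I_n.+1 -> nat) (p : {mpoly k[n.+1]}) :
    Prop :=
  forall A, Lambda e alpha A -> lin_act A p = p.

Definition invariant_monomial e alpha (D : nat) (w : 'X_{1..n.+1}) : Prop :=
  mdeg w = D /\ invariant e alpha 'X_[w].

(* All multinomials of degree D lie in the finite type 'X_{1..n.+1 < D.+1}. *)
Definition num_invariant_monomials e alpha (D : nat) : nat :=
  #|[set w : 'X_{1..n.+1 < D.+1} | `[< invariant_monomial e alpha D w >]]|.

Definition monomial_map mu (m : mu.-tuple 'X_{1..n.+1}) (x : 'rV[k]_n.+1) :
    'rV[k]_mu :=
  \row_(i < mu) ('X_[tnth m i] : {mpoly k[n.+1]}).@[x ord0].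

(* The image of P^n under [x] |-> [monomial_map m x]. A vector x at which all
   the monomials vanish contributes nothing, as a point P has dimension 1. *)
Definition monomial_image mu (m : mu.-tuple 'X_{1..n.+1}) (P : proj_point k mu) :
    Prop :=
  exists2 x : 'rV[k]_n.+1, x != 0 & val P = <[monomial_map m x]>%VS.

End Invariants.

(* Main.v *)
Require Import Defs.
From mathcomp Require Import all_boot all_order all_algebra.
From mathcomp.classical Require Import boolp.
From mathcomp Require Import mpoly zify.

Set Implicit Arguments.
Unset Strict Implicit.
Unset Printing Implicit Defensive.

Import GRing.Theory.
Local Open Scope ring_scope.

(** Let [phi] be the ring morphism from [k[w_1,...,w_mu]] to
    [k[x_0,...,x_n]] that sends [w_i] to the monomial [m_i]. A form [f] of
    degree [t >= 1] lies in the ideal of the image of the monomial map exactly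
    when [phi f = 0]: evaluating [f] along the map is evaluating [phi f] on
    [k^(n+1)], and a polynomial that vanishes everywhere over an infinite field
    is zero ([meval_eq0]). Hence the degree [t] part of the coordinate ring is
    isomorphic to [phi (S_t)], which is spanned by the products of [t] of the
    [m_i]; as distinct monomials are linearly independent, its dimension is the
    number of monomials that are such products
    ([hilbert_function_monomial_image]).

    A monomial [x^w] is fixed by the group exactly when [d] divides the weight
    [\sum_i alpha_i w_i], since [e] has order [d] ([invariant_weight]). A
    product of [t] invariant monomials of degree [d] is thus an invariant
    monomial of degree [t d], and the content of the theorem is the converse:
    every invariant monomial of degree [t d] is such a product
    ([factor_into_generators]). For [t = 1] it is one of the [m_i]. For [t >=
    2], read it as a sequence of [t d] variables, [x_i] having weight
    [alpha_i]. The sequence has at least [2d - 1] terms, so by the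
    Erdos-Ginzburg-Ziv theorem some [d] of them have total weight divisible by
    [d]. They form an invariant factor of degree [d], and the cofactor is
    invariant of degree [(t - 1) d].

    The Erdos-Ginzburg-Ziv theorem itself is multiplicative in [d]
    ([egz_mul]), which reduces it to a prime [p]. There one sorts the terms by
    their residues and matches those of rank [i] and [i + p - 1]. Either some
    matched residues agree, and then [p] consecutive terms are congruent, or
    choosing one term in each of the [p - 1] pairs gives sums in all the residue
    classes modulo [p] ([choice_sums_card]), in particular in that of the
    opposite of a remaining term. *)

(** * The Erdos-Ginzburg-Ziv theorem *)

Section PrimeCase.
Variables (p : nat) (T : eqType) (g : T -> 'F_p).

Fixpoint choice_sums (l : seq (T * T)) : {set 'F_p} :=
  if l is (x, y) :: l' then
    [set g x + v | v in choice_sums l'] :|: [set g y + v | v in choice_sums l']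
  else [set 0].

Lemma choice_sumsP l z : z \in choice_sums l ->
  exists c r, [/\ perm_eq (unzip1 l ++ unzip2 l) (c ++ r), size c = size l
                & \sum_(x <- c) g x = z].
Proof.
elim: l z => [|[x y] l IHl] z /=.
  by rewrite inE => /eqP->; exists [::], [::]; rewrite big_nil.
case/setUP=> /imsetP[v /IHl[c [r [lcr szc cv]]] ->].
  exists (x :: c), (y :: r); split; rewrite /= ?szc ?big_cons ?cv //.
  by apply/permP=> P; move/permP/(_ P): lcr; rewrite /= !count_cat /=; lia.
exists (y :: c), (x :: r); split; rewrite /= ?szc ?big_cons ?cv //.
by apply/permP=> P; move/permP/(_ P): lcr; rewrite /= !count_cat /=; lia.
Qed.

(** A nonzero [c] generates the additive group of ['F_p]. *)
Lemma translate_invariant (A : {set 'F_p}) c a :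
    prime p -> c != 0 -> a \in A -> (forall v, v \in A -> c + v \in A) ->
  A = setT.
Proof.
move=> p_pr c0 aA cA; apply/setP=> b; rewrite inE.
have -> : b = c *+ ((b - a) / c : 'F_p) + a.
  by rewrite -mulr_natr natr_Zp mulrC divfK // subrK.
by elim: (nat_of_ord _) => [|j IHj]; rewrite ?add0r // mulrS -addrA cA.
Qed.

(** The two-element case of the Cauchy-Davenport inequality, iterated: with
    [A] the sums already reached, [g x + A] and [g y + A] have the same size, so
    their union is larger than [A] unless they coincide. In that case [A] is
    invariant under translation by [g y - g x], hence is everything. *)
Lemma choice_sums_card l : prime p ->
    all (fun u => g u.1 != g u.2) l ->
  (minn p (size l).+1 <= #|choice_sums l|)%N.
Proof.
move=> p_pr; elim: l => [_|[x y] l IHl] /=; first by rewrite cards1 geq_minr.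
case/andP=> /= gxy /IHl {IHl}; set A := choice_sums l => leA.
set B := [set g x + v | v in A]; set C := [set g y + v | v in A].
have cB : #|B| = #|A| by apply: card_imset; apply: addrI.
have cC : #|C| = #|A| by apply: card_imset; apply: addrI.
have A0 : (0 < #|A|)%N.
  by apply: leq_trans leA; rewrite leq_min prime_gt0.
have [sCB | nsCB] := boolP (C \subset B).
  have AT : A = setT.
    case/card_gt0P: A0 => a aA.
    apply: (@translate_invariant _ (g y - g x) a) => //.
      by rewrite subr_eq0 eq_sym.
    move=> v vA; have /imsetP[u uA] : g y + v \in B.
      by apply: (subsetP sCB); apply/imsetP; exists v.
    by move=> yvxu; rewrite addrAC yvxu addrAC subrr add0r.
  rewrite geq_min; apply/orP; left.
  apply: leq_trans (subset_leq_card (subsetUl _ _)).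
  by rewrite cB AT cardsT card_Fp.
have : (#|B| < #|B :|: C|)%N.
  apply: proper_card; rewrite properE subsetUl /=.
  by apply: contra nsCB => /(subset_trans (subsetUr _ _)).
rewrite cB; apply: leq_trans.
rewrite geq_min in leA; rewrite geq_min.
by case/orP: leA => h; rewrite ?(leqW h) // !ltnS h orbT.
Qed.

End PrimeCase.

(** The length [d] subsequence is represented up to permutation by [c], with
    complement [r]. Quantifying over [T] and [f] lets the statement be applied
    again to a sequence of blocks, as in [egz_mul]. *)
Definition egz d := forall (T : eqType) (f : T -> nat) (s : seq T),
  (d.*2.-1 <= size s)%N ->
  exists c r, [/\ perm_eq s (c ++ r), size c = d & d %| \sum_(x <- c) f x]%N.

Lemma egz_prime p : prime p -> egz p.
Proof.
move=> p_pr T f s szs; pose g x : 'F_p := (f x)%:R.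
have pE : p = p.-1.+1 by rewrite prednK // prime_gt0.
set q := p.-1 in pE.
have dvdE c : (p %| \sum_(x <- c) f x)%N = (\sum_(x <- c) g x == 0).
  by rewrite (dvdn_pcharf (pchar_Fp p_pr)) natr_sum.
pose le := [rel x y | f x %% p <= f y %% p]%N.
have le_tr : transitive le by move=> y x z; apply: leq_trans.
have le_refl : reflexive le by move=> x; apply: leqnn.
have s_srt : sorted le (sort le s).
  by apply: sort_sorted => x y; apply: leq_total.
have: perm_eq s (sort le s) by rewrite perm_sym; apply/permPl/perm_sort.
move: (sort le s) s_srt => s' s_srt ss'.
suff [c [r [s'cr szc cg]]] : exists c r,
    [/\ perm_eq s' (c ++ r), size c = p & \sum_(x <- c) g x == 0].
  by exists c, r; rewrite dvdE; split=> //; apply: perm_trans ss' s'cr.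
rewrite (perm_size ss') pE doubleS /= {s ss'} in szs.
have x0 : T by case: (s') szs => [|x].
have szs1: (q <= size s')%N by lia.
pose l := zip (take q s') (take q (drop q s')).
have sz1 : size (take q s') = q by rewrite size_take_min; lia.
have sz2 : size (take q (drop q s')) = q.
  by rewrite size_take_min size_drop; lia.
have szl : size l = q by rewrite size_zip sz1 sz2 minnn.
(* With all the pairs separated, the [p - 1] choices reach every residue; they
   are completed by [z], the term that follows the pairs. *)
have [l_neq | ] := boolP (all (fun u => g u.1 != g u.2) l).
  case def_r: (drop q (drop q s')) => [|z r].
    by move/(congr1 size): def_r; rewrite !size_drop /=; lia.
  have : - g z \in choice_sums g l.
    suff -> : choice_sums g l = [set: _] by rewrite inE.
    apply/eqP; rewrite eqEcard subsetT cardsT card_Fp //.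
    by have := choice_sums_card p_pr l_neq; rewrite szl -pE minnn.
  case/choice_sumsP=> c [r' [lcr szc cg]].
  exists (z :: c), (r' ++ r); split; first 1 last.
  - by rewrite /= szc szl -pE.
  - by rewrite big_cons cg subrr.
  rewrite unzip1_zip ?unzip2_zip ?sz1 ?sz2 // in lcr.
  rewrite -{1}(cat_take_drop q s') -{1}(cat_take_drop q (drop q s')) def_r.
  rewrite catA perm_catC /= perm_cons perm_catC /= catA.
  by rewrite perm_cat2r.
(* A pair with equal residues: by sortedness, the [p] terms from rank [i] to
   [i + p - 1] are all congruent. *)
rewrite -has_predC => /(has_nthP (x0, x0))[i ltiq].
rewrite szl in ltiq.
rewrite /= negbK nth_zip ?sz1 ?sz2 //= !nth_take // nth_drop => /eqP gE.
exists (take p (drop i s')), (take i s' ++ drop p (drop i s')).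
have szc : size (take p (drop i s')) = p.
  by rewrite size_take_min size_drop; lia.
split=> //.
  by rewrite perm_sym perm_catCA !cat_take_drop.
have fE : f (nth x0 s' i) = f (nth x0 s' (q + i)) %[mod p].
  by rewrite -!(val_Fp_nat p_pr) -/(g _) gE.
rewrite big_seq (eq_bigr (fun=> g (nth x0 s' i))) => [|x].
  rewrite -big_seq big_const_seq count_predT szc iter_addr_0.
  by rewrite -mulr_natr pchar_Fp_0 // mulr0.
case/(nthP x0) => j; rewrite szc => ltj <-; rewrite nth_take // nth_drop.
apply/val_inj; rewrite /= !val_Fp_nat //; apply/eqP; rewrite eqn_leq.
rewrite {1}fE; apply/andP; split;
  apply: (sorted_leq_nth le_tr le_refl x0 s_srt); rewrite ?inE; lia.
Qed.

(** As long as [2d - 1] terms remain, another block of length [d] and sum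
    divisible by [d] can be removed. *)
Lemma egz_extract d k (T : eqType) (f : T -> nat) (s : seq T) :
    egz d -> (0 < d)%N -> (k * d + d.-1 <= size s)%N ->
  exists ss r, [/\ perm_eq s (flatten ss ++ r), size ss = k
    & {in ss, forall c, size c = d /\ d %| \sum_(x <- c) f x}%N].
Proof.
move=> egzd d0; elim: k s => [|k IHk] s szs; first by exists [::], s.
have [c [r [scr szc dc]]] : exists c r,
    [/\ perm_eq s (c ++ r), size c = d & d %| \sum_(x <- c) f x]%N.
  by apply: egzd; apply: leq_trans szs; rewrite mulSn -addnn; lia.
have [ss [r' [rss szss ssP]]] : exists ss r', [/\ perm_eq r (flatten ss ++ r'),
    size ss = k & {in ss, forall c, size c = d /\ d %| \sum_(x <- c) f x}%N].
  by apply: IHk; move: szs; rewrite (perm_size scr) size_cat szc mulSn; lia.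
exists (c :: ss), r'; split; rewrite ?[size _]/= ?szss //.
  by apply: perm_trans scr _; rewrite /= -catA perm_cat2l.
by move=> b; rewrite inE => /predU1P[->|/ssP].
Qed.

(** From [2ab - 1 = (2b - 1) a + (a - 1)] terms one extracts [2b - 1] blocks of
    length [a] and sum [a * h u]; the case of [b], applied to the quotients [h],
    then selects [b] of these blocks. *)
Lemma egz_mul a b : (0 < a)%N -> (0 < b)%N -> egz a -> egz b -> egz (a * b).
Proof.
move=> a0 b0 egza egzb T f s szs.
have [|ss [r [s_ss szss ssP]]] := @egz_extract a b.*2.-1 T f s egza a0.
  apply: leq_trans szs; nia.
pose h u := ((\sum_(x <- u) f x) %/ a)%N.
have [|cc [rr [sscr szcc bcc]]] := egzb _ h ss; first by rewrite szss.
have ccP: {in cc, forall c, size c = a /\ a %| \sum_(x <- c) f x}%N.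
  by move=> c ccc; apply: ssP; rewrite (perm_mem sscr) mem_cat ccc.
exists (flatten cc), (flatten rr ++ r); split.
- rewrite catA -flatten_cat; apply: perm_trans s_ss _.
  by rewrite perm_cat2r; apply: perm_flatten.
- rewrite size_flatten /shape sumnE big_map big_seq (eq_bigr (fun=> a)).
    by rewrite -big_seq big_const_seq count_predT szcc iter_addn_0.
  by move=> c /ccP[].
- rewrite big_flatten big_seq (eq_bigr (fun c => a * h c)%N).
    by rewrite -big_seq -big_distrr dvdn_pmul2l.
  by move=> c /ccP[_ ac]; rewrite mulnC divnK.
Qed.

Theorem erdos_ginzburg_ziv d : (0 < d)%N -> egz d.
Proof.
elim/ltn_ind: d => d IHd d0; have [d1|d1] := leqP d 1.
  have -> : d = 1%N by lia.
  move=> T f [|x s] // _; exists [:: x], s; split=> //; exact: dvd1n.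
have p_pr := pdiv_prime d1; have p_dvd := pdiv_dvd d.
rewrite -(divnK p_dvd); have p1 := prime_gt1 p_pr.
have q0 : (0 < d %/ pdiv d)%N by rewrite divn_gt0 // (dvdn_leq d0 p_dvd).
apply: egz_mul => //.
  by apply: IHd => //; apply: ltn_Pdiv.
exact: egz_prime.
Qed.

(** * Polynomials vanishing everywhere *)

Lemma base_expansion_inj N n (a b : 'I_n -> nat) :
    (forall i, a i < N)%N -> (forall i, b i < N)%N ->
  (\sum_(i < n) a i * N ^ i = \sum_(i < n) b i * N ^ i)%N -> a =1 b.
Proof.
elim: n a b => [|n IHn] a b aN bN; first by move=> _ [].
have split_low c : (\sum_(i < n.+1) c i * N ^ i =
    (\sum_(i < n) c (lift ord0 i) * N ^ i) * N + c ord0)%N.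
  rewrite big_ord_recl expn0 muln1 addnC big_distrl /=; congr addn.
  by apply: eq_bigr => i _; rewrite /bump /= add1n expnSr mulnA.
have N0 : (0 < N)%N by apply: leq_ltn_trans (aN ord0).
rewrite !split_low => eq_ab.
have ab0 : a ord0 = b ord0.
  by move/(congr1 (modn^~ N)): eq_ab; rewrite !modnMDl !modn_small.
have abS : (\sum_(i < n) a (lift ord0 i) * N ^ i =
            \sum_(i < n) b (lift ord0 i) * N ^ i)%N.
  by move/(congr1 (divn^~ N)): eq_ab; rewrite !divnMDl // !divn_small // !addn0.
move=> i; case: (unliftP ord0 i) => [j|] -> //.
by apply: (IHn (fun j => a (lift ord0 j)) (fun j => b (lift ord0 j))).
Qed.

(** Kronecker substitution: for [N] larger than all the exponents of [f],
    setting [x_i = y ^ (N ^ i)] gives a polynomial in [y] whose coefficients are those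
    of [f], because the exponent of [y] determines the exponents of the [x_i]
    by its digits in base [N]. *)
Lemma meval_eq0 (k : closedFieldType) n (f : {mpoly k[n]}) :
  (forall v : 'I_n -> k, f.@[v] = 0) -> f = 0.
Proof.
move=> f0; set N := msize f.
pose kr (w : 'X_{1..n}) := (\sum_(i < n) w i * N ^ i)%N.
pose P : {poly k} := \sum_(w <- msupp f) f@_w *: 'X^(kr w).
have Py y : P.[y] = 0.
  rewrite -(f0 (fun i => y ^+ (N ^ i))) mevalE horner_sum.
  apply: eq_bigr => w _.
  rewrite hornerZ hornerXn /kr -prodrXr; congr (_ * _); apply: eq_bigr => i _.
  by rewrite mulnC exprM.
have P0 : P = 0.
  apply/eqP; apply: contraT => /closed_nonrootP[y].
  by rewrite /root Py eqxx.
have ltN w i : w \in msupp f -> (w i < N)%N.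
  move=> /msize_mdeg_lt; apply: leq_ltn_trans.
  by rewrite mdegE (bigD1 i) //= leq_addr.
apply/mpolyP=> w; rewrite mcoeff0; apply/eqP; rewrite mcoeff_eq0.
apply/negP=> wf; have := congr1 (coefp (kr w)) P0.
rewrite /= coef0 coef_sum (bigD1_seq w) ?msupp_uniq //= coefZ coefXn eqxx mulr1.
rewrite big_seq_cond big1 ?addr0 => [/eqP|u /andP[uf uw]].
  by rewrite mcoeff_eq0 wf.
rewrite coefZ coefXn; case: eqP => [kr_wu | _]; last by rewrite mulr0.
case/eqP: uw; apply/mnmP => i.
by apply: esym; apply: (base_expansion_inj (N := N) _ _ kr_wu) => j; apply: ltN.
Qed.

(** * The homogeneous ideal of a monomial image *)
Section MonomialImage.
Variables (k : closedFieldType) (n mu : nat) (m : mu.-tuple 'X_{1..n.+1}).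
Hypothesis m_neq0 : forall i, tnth m i != 0%MM.

(** The map on coordinate rings induced by the monomial map. *)
Definition monomial_pullback (f : {mpoly k[mu]}) : {mpoly k[n.+1]} :=
  f \mPo [tuple 'X_[tnth m i] | i < mu].

(** The exponent of the monomial to which the pullback sends ['X_[u]]. *)
Definition mnm_image (u : 'X_{1..mu}) : 'X_{1..n.+1} :=
  (\sum_(i < mu) tnth m i *+ u i)%MM.

Lemma mnm_imageD u1 u2 : mnm_image (u1 + u2)%MM =
  (mnm_image u1 + mnm_image u2)%MM.
Proof.
rewrite /mnm_image -big_split; apply: eq_bigr => i _ /=.
by apply/mnmP=> j; rewrite !(mnmDE, mulmnE) mulnDr.
Qed.

Lemma mnm_imageU i : mnm_image U_(i)%MM = tnth m i.
Proof.
rewrite /mnm_image (bigD1 i) //= mnm1E eqxx mulm1n big1 ?addm0 // => j ji.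
by rewrite mnm1E eq_sym (negPf ji) mulm0n.
Qed.

Lemma monomial_pullbackX u : monomial_pullback 'X_[u] = 'X_[mnm_image u].
Proof.
rewrite /monomial_pullback comp_mpolyX.
rewrite (big_morph _ (@mpolyXD _ _) (@mpolyX0 _ _)); apply: eq_bigr => i _.
by rewrite tnth_mktuple mpolyXn.
Qed.

Lemma monomial_pullbackE f :
  monomial_pullback f = \sum_(u <- msupp f) f@_u *: 'X_[mnm_image u].
Proof.
rewrite /monomial_pullback comp_mpolyEX.
by apply: eq_bigr => u _; rewrite -/(monomial_pullback _) monomial_pullbackX.
Qed.

Lemma meval_monomial_map f (x : 'rV[k]_n.+1) :
  f.@[monomial_map m x ord0] = (monomial_pullback f).@[x ord0].
Proof.
rewrite comp_mpoly_meval; apply: meval_eq => i.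
by rewrite tnth_mktuple mxE.
Qed.

(** This is why the vanishing of a form at one nonzero vector of a line
    implies its vanishing on the whole line. *)
Lemma meval_scale t (f : {mpoly k[mu]}) (c : k) (v : 'rV[k]_mu) :
  f \is t.-homog -> f.@[(c *: v) ord0] = c ^+ t * f.@[v ord0].
Proof.
move=> f_t; rewrite !mevalE big_distrr /= [LHS]big_seq [RHS]big_seq.
apply: eq_bigr => u uf; rewrite mulrCA; congr (_ * _).
have u_t : mdeg u = t := dhomog_mf f_t uf.
rewrite -u_t mdegE -prodrXr -big_split /=.
by apply: eq_bigr => i _; rewrite mxE exprMn.
Qed.

(** The values of the pullback of [f] are those of [f] on the cone over the
    image, so the nullity of the pullback amounts to the vanishing of [f] on
    this cone. *)
Lemma vanishing_monomial_image t (f : {mpoly k[mu]}) :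
    (0 < t)%N -> f \is t.-homog ->
  vanishing_ideal (monomial_image m) f <-> monomial_pullback f = 0.
Proof.
move=> t0 f_t; split=> [[s s_gen fE] | f0].
  apply: meval_eq0 => v.
  have -> : (monomial_pullback f).@[v] = f.@[monomial_map m (\row_i v i) ord0].
    by rewrite meval_monomial_map; apply: meval_eq => i; rewrite mxE.
  set x := \row_i v i; set y := monomial_map m x.
  (* If [y = 0] then [x] has no image point, but [f] vanishes at the origin
     since its degree is positive. *)
  have [y0 | y_neq0] := eqVneq y 0.
    rewrite y0 -(scale0r 0) (meval_scale _ _ f_t).
    by rewrite expr0n -leqn0 leqNgt t0 mul0r.
  have dim_y : \dim <[y]>%VS == 1%N by rewrite dim_vline y_neq0.
  have x_neq0 : x != 0.
    apply: contraNneq y_neq0 => x0; apply/eqP/rowP => i; rewrite mxE mevalX mxE.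
    have [j mj] : exists j, tnth m i j != 0%N.
      apply/existsP; apply: contraNT (m_neq0 i).
      rewrite negb_exists => /forallP m0.
      by apply/eqP/mnmP => j; rewrite mnm0E; apply/eqP; rewrite -[_ == _]negbK.
    by rewrite (bigD1 j) //= x0 mxE expr0n (negPf mj) mul0r.
  rewrite fE rmorph_sum big_seq big1 //= => p ps; rewrite mevalM.
  have [_ /(_ (exist _ <[y]>%VS dim_y)) van] := s_gen p ps.
  by rewrite van ?mulr0 ?memv_line //; exists x.
exists [:: (1, f)]; last by rewrite big_seq1 mul1r.
move=> p; rewrite inE => /eqP-> /=; split; first by exists t.
move=> P [x _ P_x] v; rewrite P_x => /vlineP[c ->] _.
by rewrite (meval_scale _ _ f_t) meval_monomial_map f0 meval0 mulr0.
Qed.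

(** Choosing one [u] of degree [t] above each [w i] gives a basis ['X_[u i]] of
    the degree [t] part modulo the ideal: the pullback is injective modulo the
    ideal and sends this family to the distinct monomials ['X_[w i]], which
    span its image. *)
Lemma hilbert_function_monomial_image t h (w : 'I_h -> 'X_{1..n.+1}) :
    (0 < t)%N -> injective w ->
    (forall u, mdeg u = t -> exists i, mnm_image u = w i) ->
    (forall i, exists u, mdeg u = t /\ mnm_image u = w i) ->
  hilbert_function (@monomial_image k n mu m) t = h.
Proof.
move=> t0 w_inj w_im im_w; have [u uw] := choice im_w.
pose b i : dhomog mu k t := indhomog t 'X_[u i].
have bE i : val (b i) = 'X_[u i].
  have [u_t _] := uw i; rewrite /b /indhomog insubdK //.
  by rewrite -topredE /= dhomogX; apply/eqP.
have pb_sum (c : 'I_h -> k) : monomial_pullback (val (\sum_i c i *: b i)) =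
    \sum_i c i *: 'X_[w i].
  rewrite raddf_sum /= [LHS]raddf_sum /=; apply: eq_bigr => i _.
  rewrite [LHS]linearZ /= -/(val (b i)) bE -/(monomial_pullback _).
  by rewrite monomial_pullbackX; have [_ ->] := uw i.
have coef_sum (c : 'I_h -> k) i : (\sum_j c j *: 'X_[w j])@_(w i) = c i.
  rewrite raddf_sum /= (bigD1 i) //= mcoeffZ mcoeffX eqxx mulr1 big1 ?addr0 //.
  by move=> j ji; rewrite mcoeffZ mcoeffX (inj_eq w_inj) (negPf ji) mulr0.
have vanE (f : dhomog mu k t) : vanishing_ideal (monomial_image m) (val f) <->
    monomial_pullback (val f) = 0.
  by apply: vanishing_monomial_image t0 _; apply: dhomog_is_dhomog.
apply: (quotient_dim_unique (b := b)); first exact: vanishing_ideal_subspace.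
split=> [f | c /vanE].
  exists (fun i => (monomial_pullback (val f))@_(w i)); apply/vanE.
  rewrite [val _]raddfB /= [LHS]raddfB /= -![_ \mPo _]/(monomial_pullback _).
  rewrite pb_sum; apply/eqP; rewrite subr_eq0; apply/eqP/mpolyP => z.
  have [[i ->] | z_im] := pselect (exists i, z = w i).
    by rewrite coef_sum.
  rewrite [RHS]raddf_sum [RHS]big1 => [|i _] /=; last first.
    rewrite mcoeffZ mcoeffX; case: eqP => [wz|_]; last exact: mulr0.
    by case: z_im; exists i.
  rewrite monomial_pullbackE raddf_sum big_seq big1 //= => v vf.
  rewrite mcoeffZ mcoeffX; case: eqP => [wz|_]; last exact: mulr0.
  case: z_im; rewrite -wz; apply: w_im.
  exact: (dhomog_mf (dhomog_is_dhomog f) vf).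
by rewrite pb_sum => c0 i; rewrite -(coef_sum c i) c0 mcoeff0.
Qed.

End MonomialImage.

(** * Invariant monomials *)
Section Invariants.
Variables (k : closedFieldType) (n d : nat) (e : k) (alpha : 'I_n.+1 -> nat).
Hypothesis e_prim : d.-primitive_root e.

Definition weight (w : 'X_{1..n.+1}) : nat := (\sum_i alpha i * w i)%N.

Lemma weightD w1 w2 : weight (w1 + w2)%MM = (weight w1 + weight w2)%N.
Proof.
by rewrite /weight -big_split; apply: eq_bigr => i _; rewrite mnmDE mulnDr.
Qed.

Lemma diag_mx_expz (c : 'rV[k]_n.+1) (j : int) :
  (forall i, c ord0 i != 0) -> diag_mx c ^ j = diag_mx (\row_i c ord0 i ^ j).
Proof.
move=> c0.
have expn (l : nat) : diag_mx c ^+ l = diag_mx (\row_i c ord0 i ^+ l).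
  elim: l => [|l IHl].
    by apply/matrixP=> i j'; rewrite !mxE expr0.
  rewrite exprS IHl -[_ * _]/(_ *m _) mulmx_diag; congr diag_mx.
  by apply/rowP=> i; rewrite !mxE exprS.
case: j => l; first exact: expn.
set B := RHS; rewrite -[LHS]/((diag_mx c ^+ l.+1)^-1).
have AB : diag_mx c ^+ l.+1 * B = 1.
  rewrite expn -[_ * _]/(_ *m _) mulmx_diag -[1]/(1%:M) -diag_const_mx.
  congr diag_mx; apply/rowP=> i; rewrite !mxE divff //.
  by rewrite expf_neq0.
rewrite -[LHS]mulr1 -AB mulKr //; exact: (mulmx1_unit AB).1.
Qed.

Lemma lin_act_diagX (c : 'rV[k]_n.+1) w :
  lin_act (diag_mx c) 'X_[w] = (\prod_i c ord0 i ^+ w i) *: 'X_[w].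
Proof.
rewrite lin_act_diag comp_mpolyX mpolyXE_id -scaler_prod.
by apply: eq_bigr => i _; rewrite tnth_mktuple exprZn.
Qed.

(** The generator multiplies ['X_[w]] by [e ^+ weight w], its [j]th power by the
    [j]th power of that scalar, and [e] has order [d]. *)
Lemma invariant_weight w : Defs.invariant e alpha 'X_[w] <-> (d %| weight w)%N.
Proof.
have e0 : e != 0.
  apply/eqP=> e0; have /eqP := prim_expr_order e_prim.
  rewrite e0 expr0n -[d == _]negbK -lt0n (prim_order_gt0 e_prim).
  by rewrite eq_sym oner_eq0.
have prodE (j : int) :
    \prod_i ((e ^+ alpha i) ^ j) ^+ w i = (e ^+ weight w) ^ j.
  have -> : e ^+ weight w = \prod_i (e ^+ alpha i) ^+ w i.
    by rewrite /weight -prodrXr; apply: eq_bigr => i _; rewrite exprM.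
  rewrite (big_morph _ (fun x y => expfzMl x y j) (exp1rz _ j)).
  by apply: eq_bigr => i _; rewrite exprnP exprzAC.
split=> [inv_w | dvd_w A [j ->]].
  have : lin_act (diag_mx (\row_i e ^+ alpha i)) 'X_[w] = 'X_[w].
    by apply: inv_w; exists 1; rewrite expr1z.
  move/(congr1 (mcoeff w)); rewrite lin_act_diagX mcoeffZ mcoeffX eqxx mulr1.
  under eq_bigr do rewrite mxE -[e ^+ _]expr1z.
  by rewrite prodE expr1z => /eqP; rewrite -(prim_order_dvd e_prim).
rewrite diag_mx_expz => [|i]; last by rewrite mxE expf_neq0.
rewrite lin_act_diagX; under eq_bigr do rewrite !mxE.
rewrite prodE; move: dvd_w; rewrite (prim_order_dvd e_prim) => /eqP->.
by rewrite exp1rz scale1r.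
Qed.

Lemma invariant_monomialE D w :
  invariant_monomial e alpha D w <-> mdeg w = D /\ (d %| weight w)%N.
Proof.
by split=> -[w_D /invariant_weight w_inv].
Qed.

End Invariants.

(** * Factorization of invariant monomials *)

Lemma sum_count_mem (T : finType) (f : T -> nat) (c : seq T) :
  (\sum_(x <- c) f x = \sum_x f x * count_mem x c)%N.
Proof.
elim: c => [|x c IHc]; first by rewrite big_nil big1 // => i _; rewrite muln0.
rewrite big_cons IHc /=; under [RHS]eq_bigr do rewrite mulnDr.
rewrite big_split /=; congr addn.
rewrite (bigD1 x) //= eqxx muln1 big1 ?addn0 // => y.
by rewrite eq_sym => /negPf->; rewrite muln0.
Qed.

(** The Erdos-Ginzburg-Ziv theorem in terms of monomials: the sequence is the
    one that lists each variable as many times as its exponent. *)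
Lemma zero_sum_factor n d (alpha : 'I_n.+1 -> nat) (w : 'X_{1..n.+1}) :
    (0 < d)%N -> (d.*2.-1 <= mdeg w)%N ->
  exists w1 w2, [/\ w = (w1 + w2)%MM, mdeg w1 = d & (d %| weight alpha w1)%N].
Proof.
move=> d0; rewrite -size_m2s => /(erdos_ginzburg_ziv d0 alpha).
case=> c [r [w_cr c_d d_c]]; exists (s2m c), (s2m r); split.
- apply/mnmP=> i; rewrite mnmDE !mnmE -count_cat -(permP w_cr).
  by rewrite -{1}(s2mK w) mnmE.
- rewrite -c_d -sum1_size sum_count_mem mdegE.
  by apply: eq_bigr => i _; rewrite mnmE mul1n.
- rewrite sum_count_mem in d_c.
  by rewrite /weight; under eq_bigr do rewrite mnmE.
Qed.

(** Induction on [t]: an invariant factor of degree [d] is split off, and the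
    weight of the cofactor is again divisible by [d]. *)
Lemma factor_into_generators n d mu (alpha : 'I_n.+1 -> nat)
    (m : mu.-tuple 'X_{1..n.+1}) t w :
    (0 < d)%N -> (forall w, mdeg w = d -> (d %| weight alpha w)%N -> w \in m) ->
    mdeg w = (t * d)%N -> (d %| weight alpha w)%N ->
  exists u, mdeg u = t /\ mnm_image m u = w.
Proof.
move=> d0 m_all; elim: t w => [|t IHt] w w_deg w_wt.
  exists 0%MM; rewrite mdeg0; split=> //.
  move/eqP: w_deg; rewrite mul0n mdeg_eq0 => /eqP->.
  by rewrite /mnm_image big1 // => i _; rewrite mnm0E mulm0n.
(* When the degree is [d] itself, the bound [2d - 1] fails as soon as [d > 1],
   but the monomial is a generator. *)
have [w1 [w2 [wE w1_deg w1_wt]]] : exists w1 w2,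
    [/\ w = (w1 + w2)%MM, mdeg w1 = d & (d %| weight alpha w1)%N].
  case: t {IHt} w_deg => [|t] w_deg.
    by exists w, 0%MM; rewrite addm0 w_deg mul1n.
  by apply: zero_sum_factor => //; rewrite w_deg !mulSn; lia.
have [u [u_t uw]] : exists u, mdeg u = t /\ mnm_image m u = w2.
  apply: IHt.
    by move: w_deg; rewrite wE mdegD w1_deg mulSn => /addnI.
  by move: w_wt; rewrite wE weightD dvdn_addr.
have /tnthP[i w1E] := m_all w1 w1_deg w1_wt.
exists (U_(i) + u)%MM; rewrite mdegD mdeg1 u_t; split=> //.
by rewrite mnm_imageD mnm_imageU uw wE w1E.
Qed.

(** * The Hilbert function *)

Theorem proposition4p3 (k : closedFieldType) (hchar : [pchar k] =i pred0)
    (n d : nat) (hn : (2 <= n)%N) (hnd : (n < d)%N)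
    (alpha : 'I_n.+1 -> nat)
    (alpha_mono : forall i j : 'I_n.+1, (i <= j)%N -> (alpha i <= alpha j)%N)
    (alpha_lt : forall i : 'I_n.+1, (alpha i < d)%N)
    (hgcd : gcdn (\big[gcdn/0%N]_(i < n.+1) alpha i) d = 1%N)
    (e : k) (he : d.-primitive_root e)
    (mu : nat) (m : mu.-tuple 'X_{1..n.+1}) (m_uniq : uniq m)
    (m_all : forall w : 'X_{1..n.+1},
       w \in m <-> invariant_monomial e alpha d w)
    (t : nat) (ht : (1 <= t)%N) :
  hilbert_function (@monomial_image k n mu m) t =
    num_invariant_monomials e alpha (t * d).
Proof.
have d0 := prim_order_gt0 he.
have mP w : w \in m <-> mdeg w = d /\ (d %| weight alpha w)%N.
  by apply: iff_trans (m_all w) _; apply: invariant_monomialE.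
have m_i i : mdeg (tnth m i) = d /\ (d %| weight alpha (tnth m i))%N.
  by apply/mP; apply: mem_tnth.
have m_neq0 i : tnth m i != 0%MM by rewrite -mdeg_eq0 (m_i i).1 -lt0n.
rewrite /num_invariant_monomials; set A := finset _.
have AP (w : 'X_{1..n.+1 < (t * d).+1}) :
    w \in A <-> mdeg w = (t * d)%N /\ (d %| weight alpha w)%N.
  rewrite inE -(invariant_monomialE _ he).
  by split=> [/asboolP | ?]; last apply/asboolP.
apply: (@hilbert_function_monomial_image _ _ _ _ m_neq0 _ _
  (fun i : 'I_#|A| => val (enum_val i)) ht).
- by move=> i j /val_inj/enum_val_inj.
- move=> u u_t.
  have im_deg : mdeg (mnm_image m u) = (t * d)%N.
    rewrite /mnm_image mdeg_sum -u_t mdegE big_distrl /=.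
    by apply: eq_bigr => i _; rewrite mdegMn (m_i i).1 mulnC.
  have im_lt : (mdeg (mnm_image m u) < (t * d).+1)%N by rewrite im_deg.
  have imA : BMultinom im_lt \in A.
    apply/AP; split=> //=; rewrite /mnm_image.
    rewrite (big_morph _ (@weightD _ _) (_ : weight _ 0%MM = 0%N)); last first.
      by rewrite /weight big1 // => i _; rewrite mnm0E muln0.
    apply: dvdn_sum => i _; elim: (u i) => [|l IHl].
      by rewrite /weight big1 // => j _; rewrite mulm0n mnm0E muln0.
    by rewrite mulmS weightD dvdn_add ?(m_i i).2.
  by exists (enum_rank_in imA (BMultinom im_lt)); rewrite enum_rankK_in.
- move=> i; have /AP[w_deg w_wt] := enum_valP i.
  by apply: (@factor_into_generators _ d _ alpha) => // w ? ?; apply/mP.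
Qed.
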